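(* Let $(X_i)_{i\ge 1}$ be an i.i.d. sequence of real-valued random variables with arbitrary common distribution (no moment or symmetry assumptions), and let $S_n=\sum_{i=1}^n X_i$. Let $l\in\mathbb{R}$. Then the probability that the random walk crosses the level $l$ at time $n$ is $O(n^{-1/2})$ as $n\to\infty$: there is a constant $C<\infty$ (which may depend on the distribution of $X_1$ and on $l$, but not on $n$) such that for all $n\ge 1$ $$P\big(\operatorname{sgn}(S_n-l)\neq \operatorname{sgn}(S_{n-1}-l)\big)\le C\,n^{-1/2}.$$
   Context: Convention: $S_0=0$, and $\operatorname{sgn}:\mathbb{R}\to\{-1,0,1\}$ is the usual sign function, with $\operatorname{sgn}(0)=0$. The random walk is said to cross the level $l$ at time $n$ if $\operatorname{sgn}(S_n-l)\neq\operatorname{sgn}(S_{n-1}-l)$. *)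

(* Defs.v *)
From HB Require Import structures.
From mathcomp Require Import all_boot all_order all_algebra finmap.
From mathcomp Require Import all_classical all_reals all_analysis.

Set Implicit Arguments.
Unset Strict Implicit.
Unset Printing Implicit Defensive.
Import Order.TTheory GRing.Theory Num.Theory.
Import numFieldNormedType.Exports.
Local Open Scope classical_set_scope.
Local Open Scope ring_scope.

Section Iid.
Context d d' (T : measurableType d) (T' : measurableType d').
Context (R : realType) (P : probability T R).

Definition mutually_independent (I : choiceType) (X : I -> {RV P >-> T'}) :=
  forall (J : {fset I}) (A : I -> set T'),
    (forall j, j \in J -> measurable (A j)) ->
    P (\bigcap_(j in [set` J]) (X j @^-1` A j)) =
      (\prod_(j <- J) P (X j @^-1` A j))%E.

Definition identically_distributed (I : Type) (X : I -> {RV P >-> T'}) :=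
  forall (i j : I) (A : set T'), measurable A ->
    distribution P (X i) A = distribution P (X j) A.

Definition iid (I : choiceType) (X : I -> {RV P >-> T'}) :=
  mutually_independent X /\ identically_distributed X.

End Iid.

Section RandomWalk.
Context d (T : measurableType d) (R : realType) (P : probability T R).

(* The steps are indexed from 0: [X i] is the (i+1)-st step, so that
   [random_walk X 0] is the zero function and [random_walk X n] is the sum of
   the first [n] steps. *)
Definition random_walk (X : nat -> {RV P >-> R}) (n : nat) (w : T) : R :=
  \sum_(i < n) X i w.

(* Meaningful for times [n >= 1] only. *)
Definition crosses_level (X : nat -> {RV P >-> R}) (l : R) (n : nat) : set T :=
  [set w | Num.sg (random_walk X n w - l)
           != Num.sg (random_walk X n.-1 w - l)].

End RandomWalk.

(* Main.v *)
Require Import Defs.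
From HB Require Import structures.
From mathcomp Require Import all_boot all_order all_algebra finmap.
From mathcomp Require Import all_classical all_reals all_analysis.
From mathcomp Require Import perm measurable_realfun ring lra zify.

Set Implicit Arguments.
Unset Strict Implicit.
Unset Printing Implicit Defensive.
Import Order.TTheory GRing.Theory Num.Theory.
Import numFieldNormedType.Exports.
Local Open Scope classical_set_scope.
Local Open Scope ring_scope.

(** A monotone function on the hypercube has total influence at most the square
    root of the dimension, and the crossing probability is an influence.

    Let U be a half-line bounded by l, and suppose that S_n lies in U while
    S_(n-1) does not, say with U unbounded above. If the last step is replaced
    by an independent nonpositive step, the walk stays outside U. So the
    probability of entering U at time n, times P(X <= 0), is at most the
    probability that resampling the last step changes membership in U
    ([enters_le]). To bound the latter, take two independent copies of each of
    the n steps and let a point b of the cube choose one copy for each time.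
    Exchangeability ([step_path_law]) makes the probability of a change the
    same for every b and every resampled time. For fixed values of the 2n steps,
    membership of the resulting sum in U is, up to relabelling the two copies by
    their order, a monotone function of b, so at most 2^n sqrt n of the n 2^n
    pairs (b, i) are pivotal ([threshold_influence_le]). Averaging gives
    1 / sqrt n ([resampled_influence_le]). Leaving U is symmetric, with
    P(X >= 0) in place of P(X <= 0), and a crossing enters or leaves one of the
    half-lines (l, oo) and [l, oo) ([crosses_levelSE]).

    This settles the case where P(X <= 0) and P(X >= 0) are both positive. If
    one of them vanishes, the walk is almost surely strictly monotone and
    |S_n| = V_n, where V_n is the sum of the |X_i| for i <= n; a crossing at
    time n + 1 forces V_n <= |l|. Here a renewal argument gives O(1/n): if
    q = P(|X| >= delta) > 0, then steps of size at least delta taken while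
    V_m <= L occur at most L / delta + 1 times, and each m < n contributes
    q P(V_m <= L) >= q P(V_n <= L) to their expected number
    ([abs_walk_le]). *)

(** * Total influence of a threshold function on the hypercube *)

Section Hypercube.
Context (R : realType) (n : nat).
Notation cube := {ffun 'I_n -> bool}.

Definition flip (b : cube) (i : 'I_n) : cube := [ffun k => b k (+) (k == i)].

Lemma flipK i : involutive (flip^~ i).
Proof. by move=> b; apply/ffunP => k; rewrite !ffunE -addbA addbb addbF. Qed.

(** The degree-one characters of the cube (Z/2)^n; [s] chooses which value of
    coordinate [i] gets the sign +1. *)
Definition character (s : 'I_n -> bool) (i : 'I_n) (b : cube) : R :=
  (-1) ^+ (b i (+) s i).

Lemma character_flip s i j b :
  character s i (flip b j) = (-1) ^+ (i == j) * character s i b.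
Proof. by rewrite /character ffunE addbAC signr_addb mulrC. Qed.

Lemma sum_characterM s i j :
  \sum_b character s i b * character s j b = (i == j)%:R * 2 ^+ n.
Proof.
have [<-|ij] := eqVneq i j.
  rewrite mul1r (eq_bigr (fun=> 1)) => [|b _]; last by rewrite -expr2 sqrr_sign.
  by rewrite sumr_const card_ffun card_bool card_ord -natrX.
rewrite mul0r; set x := (LHS).
suff : x = - x by lra.
rewrite {1}/x (reindex_inj (can_inj (flipK i))) -sumrN; apply: eq_bigr => b _ /=.
by rewrite !character_flip eqxx eq_sym (negbTE ij) expr1 expr0 mul1r mulN1r mulNr.
Qed.

(** Exchanging the sums, the left side is the correlation of [G] with
    t = \sum_i character s i. By orthogonality the second moment of t is n, so
    this correlation is at most E|t| <= sqrt n. *)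
Lemma sum_character_le s (G : cube -> R) : (forall b, `|G b| <= 1) ->
  \sum_b \sum_i character s i b * G b <= 2 ^+ n * Num.sqrt n%:R.
Proof.
move=> G1; case: (posnP n) => [n0|n_gt0].
  rewrite big1 ?mulr_ge0 ?sqrtr_ge0 ?exprn_ge0// => b _.
  by rewrite big1// => -[i ilt]; exfalso; move: ilt; rewrite n0.
have r0 : 0 < Num.sqrt n%:R :> R by rewrite sqrtr_gt0 ltr0n.
have rr : Num.sqrt n%:R * Num.sqrt n%:R = n%:R :> R.
  by rewrite -expr2 sqr_sqrtr.
move: r0 rr; set r := Num.sqrt _ => r0 rr.
(* t g <= |t| <= (t^2 / r + r) / 2 *)
have amgm t g : `|g| <= 1 -> t * g <= (t ^+ 2 / r + r) / 2.
  move=> g1; apply: (@le_trans _ _ `|t|).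
    rewrite (le_trans (ler_norm _))// normrM.
    by rewrite -[leRHS]mulr1 ler_wpM2l.
  rewrite ler_pdivlMr// -(ler_pM2r r0) mulrDl divfK ?gt_eqF//.
  rewrite -real_normK ?num_real//; have := sqr_ge0 (`|t| - r); nra.
have pw b : \sum_i character s i b * G b <=
    ((\sum_i character s i b) ^+ 2 / r + r) / 2.
  by rewrite -mulr_suml; exact: amgm.
apply: (le_trans (ler_sum _ (fun b _ => pw b))).
rewrite -mulr_suml big_split/= -mulr_suml sumr_const card_ffun card_bool card_ord.
have -> : \sum_b (\sum_i character s i b) ^+ 2 = 2 ^+ n * n%:R :> R.
  transitivity (\sum_b \sum_i \sum_j character s i b * character s j b).
    by apply: eq_bigr => b _; rewrite expr2 big_distrlr.
  rewrite exchange_big/= (eq_bigr (fun=> 2 ^+ n)) => [|i _].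
    by rewrite sumr_const card_ord mulr_natr.
  rewrite exchange_big/= (eq_bigr _ (fun j _ => sum_characterM s i j)).
  rewrite (bigD1 i)//= eqxx mul1r big1 ?addr0// => j.
  by rewrite eq_sym => /negbTE->; rewrite mul0r.
rewrite -rr -[r *+ _]mulr_natl natrX mulrA mulfK ?gt_eqF//.
lra.
Qed.

(** Let [s] mark the coordinates where the larger of the two values is chosen by
    [true]. Then [U (S b)] is monotone in each coordinate read through [s], so the
    change at [i] is exactly [character s i b] times the half-difference of the
    signed indicator [G]. Summed over [b], the half-difference folds into the
    correlation of [G] with the character, which [sum_character_le] controls. *)
Lemma threshold_influence_le (U : set R) (a c : 'I_n -> R)
    (S := fun b : cube => \sum_i if b i then c i else a i) :
  (forall x y, x <= y -> U x -> U y) ->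
  \sum_b \sum_i ((S b \in U) != (S (flip b i) \in U))%:R
    <= 2 ^+ n * Num.sqrt n%:R :> R.
Proof.
move=> Uup; pose s i := a i <= c i.
pose G b : R := (-1) ^+ (S b \notin U).
have Sflip b i : S (flip b i) = S b + if b i then a i - c i else c i - a i.
  rewrite /S (bigD1 i)//= [in RHS](bigD1 i)//= ffunE eqxx addbT.
  rewrite [in RHS]addrAC; congr (_ + _); first by case: (b i) => /=; lra.
  by apply: eq_bigr => j /negbTE ji; rewrite ffunE ji addbF.
have influE b i : ((S b \in U) != (S (flip b i) \in U))%:R =
    character s i b * (G b - G (flip b i)) / 2.
  have Ule x y : x <= y -> x \in U -> y \in U by rewrite !in_setE; exact: Uup.
  move: (Sflip b i); rewrite /character /G /s => E.
  have up (H : b i (+) (a i <= c i)) : S b \in U -> S (flip b i) \in U.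
    apply: Ule; rewrite E; move: H; case: (b i) => /=; [rewrite -ltNge|]; lra.
  have dn (H : ~~ (b i (+) (a i <= c i))) : S (flip b i) \in U -> S b \in U.
    apply: Ule; rewrite E; move: H.
    by case: (b i) => /=; [rewrite negbK|rewrite -ltNge]; lra.
  move: up dn; case: (_ (+) _); case: (S b \in U); case: (_ \in U) => //= up dn;
    rewrite ?expr1 ?expr0; try lra.
under eq_bigr do under eq_bigr do rewrite influE.
have -> : \sum_b \sum_i character s i b * (G b - G (flip b i)) / 2 =
          \sum_b \sum_i character s i b * G b.
  rewrite exchange_big [RHS]exchange_big/=; apply: eq_bigr => i _.
  rewrite -mulr_suml.
  have -> : \sum_b character s i b * (G b - G (flip b i)) =
     \sum_b character s i b * G b - \sum_b character s i b * G (flip b i).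
    by rewrite -sumrB; apply: eq_bigr => b _; rewrite mulrBr.
  have -> : \sum_b character s i b * G (flip b i) =
            - \sum_b character s i b * G b.
    rewrite (reindex_inj (can_inj (flipK i))) -sumrN; apply: eq_bigr => b _ /=.
    by rewrite character_flip eqxx expr1 flipK mulN1r mulNr.
  by lra.
by apply: sum_character_le => b; rewrite normr_sign.
Qed.

End Hypercube.

(** * Probabilities of bounded families of events *)

Section Counting.
Context d (T : measurableType d) (R : realType) (P : probability T R).

(** Expectation of the number of events that occur. *)
Lemma sum_prob_le (I : finType) (E : I -> set T) (M : R) :
  (forall i, measurable (E i)) ->
  (forall w, \sum_i (w \in E i)%:R <= M) ->
  (\sum_i P (E i) <= M%:E)%E.
Proof.
move=> mE EM.
have -> : (\sum_i P (E i) = \int[P]_w (\sum_i (\1_(E i) w)%:E))%E.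
  rewrite ge0_integral_sum//.
    by apply: eq_bigr => i _; rewrite integral_indic// setIT.
  by move=> i; exact/measurable_EFinP.
have -> : (M%:E = \int[P]_w M%:E)%E.
  by rewrite integral_cst//= probability_setT mule1.
apply: ge0_le_integral => //.
- by move=> w _; apply: sume_ge0 => i _; rewrite lee_fin.
- by apply: emeasurable_sum => i; exact/measurable_EFinP.
- by move=> w _; rewrite sumEFin lee_fin; exact: EM.
Qed.

End Counting.

(** * Finite families of reals as a measurable space *)

Section PathSpace.
Context (R : realType) (J : finType).

Definition rectangle (A : J -> set R) : set (J -> R) :=
  [set f | forall j, A j (f j)].

Definition rectangles : set (set (J -> R)) :=
  [set rectangle A | A in [set A | forall j, measurable (A j)]].

(** The finite product sigma-algebra; rectangles are taken as generators because
    they form a pi-system and their probabilities are what independence gives. *)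
Definition path_space := g_sigma_algebraType rectangles.

Lemma setI_closed_rectangles : setI_closed rectangles.
Proof.
move=> _ _ [A mA <-] [B mB <-]; exists (fun j => A j `&` B j).
  by move=> j; exact: measurableI.
apply/seteqP; split=> [f AB|f [fA fB] j]; last by split.
by split=> j; case: (AB j).
Qed.

Lemma measurable_coordinate j :
  measurable_fun [set: path_space] (fun f : path_space => (f : J -> R) j).
Proof.
move=> _ B mB; rewrite setTI; apply: sub_sigma_algebra.
exists (fun k => if k == j then B else setT); first by move=> k; case: ifP.
apply/seteqP; split=> f /=.
  by move=> /(_ j); rewrite eqxx.
by move=> Bf k; case: eqP => [->|].
Qed.

Lemma measurable_to_path d (T : measurableType d) (Y : J -> T -> R) :
  (forall j, measurable_fun setT (Y j)) ->
  measurable_fun [set: T] (fun w => (Y ^~ w : path_space)).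
Proof.
move=> mY; apply: (@measurability _ _ T path_space setT _ rectangles) => //.
move=> _ [_ [A mA <-] <-].
rewrite setTI (_ : _ @^-1` _ = \bigcap_(j in [set: J]) (Y j @^-1` A j)).
  apply: fin_bigcap_measurable; first by [].
  by move=> j _; rewrite -[X in measurable X]setTI; exact: mY.
by apply/seteqP; split=> w /= h j => [_|]; exact: h.
Qed.

(** Uniqueness of measures on a generating pi-system. *)
Lemma path_measure_unique (m1 m2 : {measure set path_space -> \bar R}) :
  (forall A, (forall j, measurable (A j)) ->
     m1 (rectangle A) = m2 (rectangle A)) ->
  (m1 setT < +oo)%E -> forall B, measurable B -> m1 B = m2 B.
Proof.
have rectT : rectangle (fun=> setT) = setT by apply/seteqP; split.
move=> m12 m1oo B mB.
apply: (@measure_unique _ R path_space rectangles (fun=> setT)) => //.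
- exact: setI_closed_rectangles.
- by move=> _; exists (fun=> setT).
- by rewrite bigcup_const.
- by move=> _ [A mA <-]; exact: m12.
Qed.

End PathSpace.

(** * Joint laws of finitely many i.i.d. steps *)

Section IidPaths.
Context d (T : measurableType d) (R : realType) (P : probability T R).
Context (I : choiceType) (X : I -> {RV P >-> R}) (iidX : iid X).

Definition step_path (J : finType) (phi : J -> I) (w : T) : path_space R J :=
  fun j => X (phi j) w.

Lemma measurable_step_path (J : finType) (phi : J -> I) :
  measurable_fun setT (step_path phi).
Proof. by apply: measurable_to_path => j; exact: measurable_funPT. Qed.

HB.instance Definition _ (J : finType) (phi : J -> I) :=
  isMeasurableFun.Build _ _ T (path_space R J) (step_path phi)
    (measurable_step_path phi).

Lemma measurable_step_path_preimage (J : finType) (phi : J -> I)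
    (B : set (path_space R J)) :
  measurable B -> measurable (step_path phi @^-1` B).
Proof.
by move=> mB; rewrite -[X in measurable X]setTI; exact: measurable_step_path.
Qed.

(** Mutual independence constrains finite sets of indices; injectivity of [phi]
    transports it to families indexed by [J]. *)
Lemma prob_rectangle (J : finType) (phi : J -> I) (A : J -> set R) :
  injective phi -> (forall j, measurable (A j)) ->
  P (step_path phi @^-1` rectangle A) = (\prod_j P (X (phi j) @^-1` A j))%E.
Proof.
move=> phi_inj mA.
pose A' i := if [pick j | phi j == i] is Some j then A j else setT.
have A'E j : A' (phi j) = A j.
  rewrite /A'; case: pickP => [k /eqP/phi_inj -> //|/(_ j)].
  by rewrite eqxx.
have := iidX.1 [fset phi j | j in J]%fset A'.
rewrite big_imfset/=; last by move=> ? ? _ _; exact: phi_inj.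
have -> : (\prod_(j <- enum (mem J)) P (X (phi j) @^-1` A' (phi j)) =
   \prod_j P (X (phi j) @^-1` A j))%E.
  by rewrite big_enum; apply: eq_bigr => j _; rewrite A'E.
move=> <-; last by move=> i _; rewrite /A'; case: pickP.
congr (P _); apply/seteqP; split => w /= h.
  by move=> _ /= /imfsetP[j _ ->]; rewrite /= A'E; exact: h.
by move=> j; rewrite -A'E; apply: (h (phi j)); rewrite /= in_imfset.
Qed.

(** Exchangeability: both joint laws have the same product values on rectangles. *)
Lemma step_path_law (J : finType) (phi psi : J -> I) (B : set (path_space R J)) :
  injective phi -> injective psi -> measurable B ->
  P (step_path phi @^-1` B) = P (step_path psi @^-1` B).
Proof.
move=> phi_inj psi_inj mB.
apply: (@path_measure_unique _ _ (distribution P (step_path phi))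
                                 (distribution P (step_path psi))) => //.
  move=> A mA.
  change (P (step_path phi @^-1` rectangle A) = P (step_path psi @^-1` rectangle A)).
  rewrite !prob_rectangle//.
  by apply: eq_bigr => j _; exact: iidX.2.
change (P (step_path phi @^-1` setT) < +oo)%E.
by rewrite preimage_setT probability_setT ltry.
Qed.

(** For fixed [A], both sides are finite measures in [B]. On a rectangle, the
    left side is the probability of a rectangle indexed by [option J], with [None]
    standing for the extra index [i]. *)
Lemma step_path_independent (J : finType) (phi : J -> I) (i : I)
    (B : set (path_space R J)) (A : set R) :
  injective phi -> (forall j, phi j != i) -> measurable B -> measurable A ->
  P (step_path phi @^-1` B `&` X i @^-1` A) =
  (P (step_path phi @^-1` B) * P (X i @^-1` A))%E.
Proof.
move=> phi_inj phi_neq mB mA.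
have mXA : measurable (X i @^-1` A) by exact: measurable_funPTI.
pose q : {nonneg R} := NngNum (fine_ge0 (measure_ge0 P (X i @^-1` A))).
have qE : (q%:num)%:E = P (X i @^-1` A) by rewrite /= fineK ?fin_num_measure.
rewrite -qE muleC.
apply: (@path_measure_unique _ _
  (pushforward (mrestr P mXA) (step_path phi))
  (mscale q (distribution P (step_path phi)))) => //.
  move=> C mC.
  change (P (step_path phi @^-1` rectangle C `&` X i @^-1` A) =
    (q%:num)%:E * P (step_path phi @^-1` rectangle C))%E.
  rewrite qE prob_rectangle//.
  pose psi (o : option J) := if o is Some j then phi j else i.
  have psi_inj : injective psi.
    move=> [j|] [k|]//= => [/phi_inj->//|/eqP|/esym/eqP];
      by rewrite (negbTE (phi_neq _)).
  pose C' (o : option J) := if o is Some j then C j else A.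
  transitivity (P (step_path psi @^-1` rectangle C')).
    congr (P _); apply/seteqP; split => w /=; first by case=> h ?; case.
    by move=> h; split; [move=> j; exact: (h (Some j))|exact: (h None)].
  rewrite (prob_rectangle psi_inj); last by case=> [j|] /=; [exact: mC|].
  rewrite (bigD1 None)//= (reindex_omap Some id)/=; last by case.
  by congr (_ * _)%E; apply: eq_bigl => j; rewrite eqxx.
change (P (step_path phi @^-1` setT `&` X i @^-1` A) < +oo)%E.
by rewrite preimage_setT setTI -qE ltry.
Qed.

End IidPaths.

(** * Resampling the last step *)

Section Resampling.
Context d (T : measurableType d) (R : realType) (P : probability T R).
Context (X : nat -> {RV P >-> R}) (iidX : iid X).

Definition upward_closed (U : set R) := forall x y, x <= y -> U x -> U y.

Lemma measurable_path_sum (J K : finType) (h : K -> J) :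
  measurable_fun [set: path_space R J] (fun f => \sum_k f (h k)).
Proof. by apply: measurable_sum => k; exact: measurable_coordinate. Qed.

Lemma measurable_mem_neq d' (T' : measurableType d') (f g : T' -> R) (U : set R) :
  measurable_fun setT f -> measurable_fun setT g -> measurable U ->
  measurable [set x | (f x \in U) != (g x \in U)].
Proof.
move=> mf mg mU; rewrite (_ : [set x | _] =
  (f @^-1` U `\` g @^-1` U) `|` (g @^-1` U `\` f @^-1` U)).
  have mfU : measurable (f @^-1` U) by rewrite -[X in measurable X]setTI; exact: mf.
  have mgU : measurable (g @^-1` U) by rewrite -[X in measurable X]setTI; exact: mg.
  by apply: measurableU; exact: measurableD.
apply/seteqP; split => x /=; rewrite -!(in_setE U);
  case: (_ \in U); case: (_ \in U) => //=; try by [left|right].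
- by move=> [[_ /(_ isT)]|[_ /(_ isT)]].
- by move=> [[]|[]].
Qed.

(** The value at time n + 1 with the last step, which has index n, replaced by the
    one of index 2n + 1. That index is the last one of the second copy when steps
    0 .. n and n + 1 .. 2n + 1 are taken as two independent copies. *)
Definition resampled_walk n (w : T) : R := random_walk X n w + X (n + n.+1)%N w.

(** The event is, up to exchanging the steps, pivotality of coordinate [i] at [b]
    for every [b] and [i]; its probability is therefore at most the largest
    possible proportion of pivotal pairs, bounded in [threshold_influence_le]. *)
Lemma resampled_influence_le (U : set R) n :
  measurable U -> upward_closed U ->
  (P [set w | (random_walk X n.+1 w \in U) != (resampled_walk n w \in U)]
     <= (Num.sqrt n.+1%:R)^-1%:E)%E.
Proof.
move=> mU upU; set E0 := [set w | _].
pose N := n.+1; pose J := ('I_N * bool)%type.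
pose idx (x : J) : nat := (x.1 + (if x.2 then N else 0))%N.
have idx_inj : injective idx.
  move=> [i e] [j f]; rewrite /idx /= => ij.
  have := ltn_ord i; have := ltn_ord j; move: ij; rewrite /N => ij ilt jlt.
  suff : e = f /\ nat_of_ord i = nat_of_ord j by move=> [-> /val_inj->].
  move: ij; case: e; case: f => ij; split => //;
    by [lia|exact: addIn ij|rewrite !addn0 in ij].
(* phi b i lists, at (k, false), the steps chosen by b and, at (k, true), the
   rejected ones, with times i and n exchanged: resampling the last coordinate of
   the reordered family flips coordinate i of b. *)
pose swap (i k : 'I_N) := tperm i ord_max k.
pose phi (b : {ffun 'I_N -> bool}) (i : 'I_N) (x : J) : nat :=
  idx (swap i x.1, x.2 (+) b (swap i x.1)).
have phi_inj b i : injective (phi b i).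
  move=> [j e] [k f] /idx_inj [] /perm_inj <- /eqP.
  by rewrite (can_eq (addbK _)) => /eqP <-.
pose D : set (path_space R J) := [set f |
  ((\sum_k f (k, false) \in U) != (\sum_k f (k, k == ord_max) \in U))].
have mD : measurable D.
  by apply: measurable_mem_neq => //; exact: (@measurable_path_sum J 'I_N).
pose S w (b : {ffun 'I_N -> bool}) := \sum_i if b i then X (i + N)%N w else X i w.
have ED b i w : (w \in step_path X (phi b i) @^-1` D) =
    ((S w b \in U) != (S w (flip b i) \in U)).
  have s1 : \sum_k step_path X (phi b i) w (k, false) = S w b.
    rewrite /S [RHS](reindex_inj (@perm_inj _ (tperm i ord_max))).
    apply: eq_bigr => k _; rewrite /step_path /phi /idx /= -/(swap i k).
    by case: (b _); rewrite ?addn0.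
  have s2 : \sum_k step_path X (phi b i) w (k, k == ord_max) = S w (flip b i).
    rewrite /S [RHS](reindex_inj (@perm_inj _ (tperm i ord_max))).
    apply: eq_bigr => k _; rewrite /step_path /phi /idx /= ffunE.
    rewrite -[X in _ (+) (_ == X)](tpermR i ord_max) (inj_eq perm_inj) addbC.
    by rewrite -/(swap i k); case: (_ (+) _); rewrite ?addn0.
  by apply/idP/idP => [/set_mem|H]; [|apply/mem_set]; rewrite /D /= s1 s2.
have EE0 : E0 = step_path X idx @^-1` D.
  have s1 w : \sum_k step_path X idx w (k, false) = random_walk X n.+1 w.
    by apply: eq_bigr => k _; rewrite /step_path /idx /= addn0.
  have s2 w : \sum_k step_path X idx w (k, k == ord_max) = resampled_walk n w.
    rewrite big_ord_recr /= /step_path /idx /= eqxx; congr (_ + _).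
    apply: eq_bigr => k _; rewrite -val_eqE /= ltn_eqF// addn0//.
  by apply/seteqP; split => w; rewrite /D /= s1 s2.
have := @sum_prob_le _ _ _ P ({ffun 'I_N -> bool} * 'I_N)%type
  (fun x => step_path X (phi x.1 x.2) @^-1` D) (2 ^+ N * Num.sqrt N%:R).
rewrite (eq_bigr (fun=> P E0)); last first.
  by move=> [b i] _; rewrite EE0; exact: step_path_law.
have mE0 : measurable E0 by rewrite EE0; exact: measurable_step_path_preimage.
have p_fin : P E0 \is a fin_num by exact: fin_num_measure.
rewrite -(fineK p_fin) sumEFin !lee_fin sumr_const.
rewrite card_prod card_ffun card_bool card_ord => H.
have {}H : fine (P E0) *+ (2 ^ N * N) <= 2 ^+ N * Num.sqrt N%:R.
  apply: H => [[b i]|w]; first exact: measurable_step_path_preimage.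
  rewrite -(pair_bigA _ (fun b i => (w \in step_path X (phi b i) @^-1` D)%:R))/=.
  under eq_bigr do under eq_bigr do rewrite ED.
  exact: threshold_influence_le.
have r0 : 0 < Num.sqrt N%:R :> R by rewrite sqrtr_gt0 ltr0n.
rewrite -[leRHS]mul1r ler_pdivlMr//.
rewrite -(ler_pM2l (exprn_gt0 N (ltr0Sn R 1))) -(ler_pM2r r0).
move: H; rewrite -[fine _ *+ _]mulr_natl natrM natrX.
rewrite -[X in _ * X * _](@sqr_sqrtr _ N%:R) ?ler0n//.
by rewrite mulr1; congr (_ <= _); rewrite /N; ring.
Qed.

End Resampling.

(** * Crossing a level *)

Section LevelCrossing.
Context d (T : measurableType d) (R : realType) (P : probability T R).
Context (X : nat -> {RV P >-> R}) (iidX : iid X).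

Definition enters (U : set R) n : set T :=
  [set w | U (random_walk X n.+1 w) /\ ~ U (random_walk X n w)].

Lemma measurable_random_walk n : measurable_fun setT (random_walk X n).
Proof. by apply: measurable_sum => i; exact: measurable_funPT. Qed.

Lemma measurable_walk_preimage n U :
  measurable U -> measurable (random_walk X n @^-1` U).
Proof.
by move=> mU; rewrite -[X in measurable X]setTI; exact: measurable_random_walk.
Qed.

Lemma measurable_enters U n : measurable U -> measurable (enters U n).
Proof.
move=> mU; rewrite (_ : enters U n = random_walk X n.+1 @^-1` U `\`
  random_walk X n @^-1` U) //.
by apply: measurableD; exact: measurable_walk_preimage.
Qed.

Lemma enters_independent U n m A : measurable U -> measurable A -> (n < m)%N ->
  P (enters U n `&` X m @^-1` A) = (P (enters U n) * P (X m @^-1` A))%E.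
Proof.
move=> mU mA nm; pose J := 'I_n.+1.
pose s1 (f : path_space R J) := \sum_k f k.
pose s2 (f : path_space R J) := \sum_(k < n) f (widen_ord (leqnSn n) k).
have ms1 : measurable_fun setT s1 by exact: (@measurable_path_sum _ J J id).
have ms2 : measurable_fun setT s2 by exact: (@measurable_path_sum _ J 'I_n).
pose B := s1 @^-1` U `\` s2 @^-1` U.
have mB : measurable B.
  by apply: measurableD; rewrite -[X in measurable X]setTI; [exact: ms1|exact: ms2].
by apply: (step_path_independent iidX (phi := @nat_of_ord n.+1) (B := B)) => //;
  [exact: val_inj|move=> j; rewrite ltn_eqF// (leq_trans _ nm)].
Qed.

(** A step in [A] cannot bring the walk into [U]; hence if the walk enters [U] and
    an independent replacement of the last step lies in [A], then resampling the
    last step changes membership in [U]. *)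
Lemma enters_le (U A : set R) n :
  measurable U -> upward_closed U \/ upward_closed (~` U) -> measurable A ->
  (forall x a, ~ U x -> A a -> ~ U (x + a)) ->
  (P (enters U n) * P (X 0 @^-1` A) <= (Num.sqrt n.+1%:R)^-1%:E)%E.
Proof.
move=> mU upU mA UA; pose m := (n + n.+1)%N.
have -> : P (X 0%N @^-1` A) = P (X m @^-1` A) by exact: iidX.2.
rewrite -enters_independent//; last by rewrite /m; lia.
pose E (V : set R) :=
  [set w | (random_walk X n.+1 w \in V) != (resampled_walk X n w \in V)].
have EC : E (~` U) = E U.
  by apply/seteqP; split => w; rewrite /E /= !in_setC; case: (_ \in U); case: (_ \in U).
have mE V : measurable V -> measurable (E V).
  move=> mV; apply: measurable_mem_neq => //; first exact: measurable_random_walk.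
  by apply: measurable_funD; [exact: measurable_random_walk|exact: measurable_funPT].
have [V [mV upV EV]] : exists V, [/\ measurable V, upward_closed V & E V = E U].
  case: upU => up; [by exists U|exists (~` U); split => //; exact: measurableC].
apply: le_trans (resampled_influence_le iidX n mV upV).
rewrite -/(E V) EV; apply: le_measure; rewrite ?inE.
- by apply: measurableI; [exact: measurable_enters|exact: measurable_funPTI].
- exact: mE.
- move=> w [[Uw NUw] Aw]; rewrite /E /= (mem_set Uw) (_ : (_ \in U) = false)//.
  by apply/negbTE; rewrite notin_setE; exact: UA.
Qed.

(** Renewal bound: see [count] in the proof, which bounds the number of large
    steps taken while the sum of absolute steps is still at most [L]. *)
Lemma abs_walk_le (L delta : R) n : 0 <= L -> 0 < delta ->
  (n%:R%:E * (P [set w | (\sum_(i < n) `|X i w| <= L)%R] *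
              P [set w | (delta <= `|X 0 w|)%R]) <= (L / delta + 1)%:E)%E.
Proof.
move=> L0 d0; pose V m w := \sum_(i < m) `|X i w|.
pose B m := [set w | V m w <= L]; pose A := [set x : R | delta <= `|x|].
have mA : measurable A.
  rewrite -[A]setTI; apply: (measurable_fun_le measurableT) => //.
have mB m : measurable (B m).
  rewrite -[B m]setTI; apply: (measurable_fun_le measurableT) => //.
  by apply: measurable_sum => i; exact: measurableT_comp.
have PBA m : P (B m `&` X m @^-1` A) = (P (B m) * P (X 0%N @^-1` A))%E.
  have -> : P (X 0%N @^-1` A) = P (X m @^-1` A) by exact: iidX.2.
  pose BP := [set f : path_space R 'I_m | \sum_k `|f k| <= L].
  have mBP : measurable BP.
    rewrite -[BP]setTI; apply: (measurable_fun_le measurableT) => //.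
    apply: measurable_sum => k; apply: measurableT_comp => //.
    exact: measurable_coordinate.
  apply: (step_path_independent iidX (phi := @nat_of_ord m) (B := BP)) => //.
    exact: val_inj.
  by move=> j; rewrite ltn_eqF.
(* Each counted step adds at least delta to V; only the last one can push V
   beyond L, hence the extra delta in the second bound. *)
have count w m : delta * \sum_(i < m) (w \in B i `&` X i @^-1` A)%:R <= V m w /\
    delta * \sum_(i < m) (w \in B i `&` X i @^-1` A)%:R <= L + delta.
  elim: m => [|m [IH1 IH2]]; first by rewrite /V !big_ord0 mulr0; split => //; lra.
  rewrite /V !big_ord_recr/= -/(V m w) mulrDr.
  have [/set_mem[BV AX]|_] := boolP (_ \in _).
    by move: BV AX; rewrite /B /A /= => BV AX; split; lra.
  by rewrite mulr0 addr0; split => //; rewrite (le_trans IH1)// lerDl.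
have : (\sum_(i < n) P (B i `&` X i @^-1` A) <= (L / delta + 1)%:E)%E.
  apply: sum_prob_le => [i|w].
    by apply: measurableI => //; exact: measurable_funPTI.
  have [_] := count w n; rewrite -ler_pdivlMl// => /le_trans; apply.
  by rewrite mulrDr mulVf ?gt_eqF// mulrC.
apply: le_trans.
have -> : (n%:R%:E = \sum_(i < n) 1%:E :> \bar R)%E.
  by rewrite sumEFin sumr_const card_ord.
rewrite ge0_sume_distrl//; apply: lee_sum => i _.
rewrite mul1e PBA; apply: lee_wpmul2r => //.
apply: le_measure; rewrite ?inE//; first exact: mB.
move=> w /=; apply: le_trans; rewrite /V.
rewrite -!(big_mkord xpredT (fun i => `|X i w|)).
rewrite (big_cat_nat (leq0n i) (ltnW (ltn_ord i)))/=.
by rewrite lerDl sumr_ge0.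
Qed.

(** The events |X| >= 1 / (k + 1) exhaust X != 0, so they cannot all be null. *)
Lemma nonzero_step_quantile : P (X 0 @^-1` [set 0]) = 0%E ->
  exists2 delta : R, 0 < delta & (0 < P [set w | (delta <= `|X 0 w|)%R])%E.
Proof.
move=> X00; apply: contrapT => none.
pose F k := [set w | k.+1%:R^-1 <= `|X 0%N w|].
have mF k : measurable (F k).
  rewrite -[F k]setTI; apply: (measurable_fun_le measurableT) => //.
  exact: measurableT_comp.
have F0 k : P.-negligible (F k).
  apply/negligibleP => //; apply/eqP; rewrite eq_le measure_ge0 andbT leNgt.
  by apply/negP => F_gt0; apply: none; exists k.+1%:R^-1.
have m0 : measurable (X 0%N @^-1` [set 0]) by exact: measurable_funPTI.
have : P.-negligible (X 0%N @^-1` [set 0] `|` \bigcup_k F k).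
  by apply: negligibleU; [exact/negligibleP|exact: negligible_bigcup].
rewrite (_ : _ `|` _ = setT).
  move/negligibleP => /(_ measurableT) PT0.
  have : (1 = 0 :> \bar R)%E by rewrite -(probability_setT P); exact: PT0.
  by move=> /eqP; rewrite onee_eq0.
apply/seteqP; split => // w _; have [X0|Xw] := eqVneq (X 0%N w) 0; first by left.
have : 0 < `|X 0%N w| by rewrite normr_gt0.
by move=> /ltr_add_invr[k]; rewrite add0r => /ltW kX; right; exists k.
Qed.

(** The sign of S - l is determined by membership of S in the open and the closed
    half-line above l. *)
Lemma crosses_levelSE l n : crosses_level X l n.+1 =
  (enters [set x | l < x] n `|` enters (~` [set x | l < x]) n) `|`
  (enters [set x | l <= x] n `|` enters (~` [set x | l <= x]) n).
Proof.
have sgE x : Num.sg (x - l) = if l < x then 1 else if x < l then -1 else 0.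
  case: ltrgtP => [lx|xl|->]; last by rewrite subrr sgr0.
  - by rewrite gtr0_sg// subr_gt0.
  - by rewrite ltr0_sg// subr_lt0.
have neq11 : 1 != -1 :> R by apply/eqP; lra.
have neq01 : 0 != -1 :> R by apply/eqP; lra.
have neq10 : 1 != 0 :> R by exact: oner_neq0.
have [neqN1 neqN0 neq_1] : [/\ -1 != 1 :> R, -1 != 0 :> R & 0 != 1 :> R].
  by rewrite ![_ == 1]eq_sym [_ == 0]eq_sym; split.
apply/seteqP; split => w; rewrite /crosses_level /enters /= !sgE;
  set a := random_walk X n.+1 w; set p := random_walk X n w;
  case: (ltrgtP l a) => la; case: (ltrgtP l p) => lp;
  rewrite ?eqxx ?trueE ?falseE /=; tauto.
Qed.

Lemma measurable_crosses_levelS l n : measurable (crosses_level X l n.+1).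
Proof.
have mU1 : measurable [set x : R | l < x] by rewrite -set_itvoy.
have mU2 : measurable [set x : R | l <= x] by rewrite -set_itvcy.
rewrite crosses_levelSE; apply: measurableU; apply: measurableU;
  by apply: measurable_enters => //; exact: measurableC.
Qed.

(** Entering a half-line above [l] is compared with a nonpositive replacement
    step, leaving it with a nonnegative one. *)
Lemma crosses_two_sided (l : R) :
  (0 < P (X 0 @^-1` [set x | (x <= 0)%R]))%E ->
  (0 < P (X 0 @^-1` [set x | (0 <= x)%R]))%E ->
  exists C : R, forall n : nat,
    (P (crosses_level X l n.+1) <= (C / Num.sqrt n.+1%:R)%:E)%E.
Proof.
move=> pm_gt0 pp_gt0.
have mU1 : measurable [set x : R | l < x] by rewrite -set_itvoy.
have mU2 : measurable [set x : R | l <= x] by rewrite -set_itvcy.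
have mm : measurable [set x : R | x <= 0] by rewrite -set_itvNyc.
have mp : measurable [set x : R | 0 <= x] by rewrite -set_itvcy.
pose a := fine (P (X 0%N @^-1` [set x | x <= 0])).
pose b := fine (P (X 0%N @^-1` [set x | 0 <= x])).
have fin (A : set R) : measurable A -> P (X 0%N @^-1` A) \is a fin_num.
  by move=> mA; apply: fin_num_measure; exact: measurable_funPTI.
have aE : P (X 0%N @^-1` [set x | x <= 0]) = a%:E by rewrite fineK ?fin.
have bE : P (X 0%N @^-1` [set x | 0 <= x]) = b%:E by rewrite fineK ?fin.
have a0 : 0 < a by rewrite -lte_fin -aE.
have b0 : 0 < b by rewrite -lte_fin -bE.
have div (x : \bar R) (r c : R) : 0 < c -> (x * c%:E <= r%:E -> x <= (c^-1 * r)%:E)%E.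
  by move=> c0; rewrite mulrC EFinM -lee_pdivlMr.
exists (2 * (a^-1 + b^-1)) => n; rewrite crosses_levelSE.
have up U : measurable U -> upward_closed U ->
    (forall x y, ~ U x -> y <= 0 -> ~ U (x + y)) ->
    (forall x y, U x -> 0 <= y -> U (x + y)) ->
    (P (enters U n `|` enters (~` U) n) <=
       ((a^-1 + b^-1) * (Num.sqrt n.+1%:R)^-1)%:E)%E.
  move=> mU upU stay_out stay_in; have mUC := measurableC mU.
  apply: le_trans (measureU2 _ _ _) _; [exact: measurable_enters..|].
  rewrite mulrDl EFinD; apply: leeD; apply: div => //.
    by rewrite -aE; apply: enters_le => //; left.
  rewrite -bE; apply: enters_le => //; first by right; rewrite setCK.
  by move=> x y /contrapT Ux y0; apply; exact: stay_in.
have mE U : measurable U -> measurable (enters U n `|` enters (~` U) n).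
  move=> mU; apply: measurableU; apply: measurable_enters => //; exact: measurableC.
apply: le_trans (measureU2 _ _ _) _; [exact: mE..|].
rewrite -mulrA mulr_natl mulr2n EFinD; apply: leeD; apply: up => //.
- by move=> x y /=; exact: (fun xy lx => lt_le_trans lx xy).
- by move=> x y /= /negP; rewrite -leNgt => xl y0; apply/negP; rewrite -leNgt; lra.
- by move=> x y /=; lra.
- by move=> x y /=; exact: (fun xy lx => le_trans lx xy).
- by move=> x y /= /negP; rewrite -ltNge => xl y0; apply/negP; rewrite -ltNge; lra.
- by move=> x y /=; lra.
Qed.

Lemma crosses_monotone_abs (l : R) n w :
  (forall i, 0 < X i w) \/ (forall i, X i w < 0) ->
  crosses_level X l n.+1 w -> \sum_(i < n) `|X i w| <= `|l|.
Proof.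
move=> mono; rewrite crosses_levelSE /enters /=.
have SE : random_walk X n.+1 w = random_walk X n w + X n w by exact: big_ord_recr.
rewrite SE; set p := random_walk X n w => H.
have l1 : l <= `|l| by exact: ler_norm.
have l2 : - l <= `|l| by rewrite -normrN ler_norm.
case: mono => mono.
  have -> : \sum_(i < n) `|X i w| = p.
    by apply: eq_bigr => i _; rewrite gtr0_norm.
  have := mono n; move: H => [[]|[]] [H1 H2] Xn; lra.
have -> : \sum_(i < n) `|X i w| = - p.
  by rewrite -sumrN; apply: eq_bigr => i _; rewrite ltr0_norm.
have := mono n; move: H => [[]|[]] [H1 H2] Xn; lra.
Qed.

(** Off a null set the steps all have the same strict sign, and the renewal bound
    gives O(1/n). *)
Lemma crosses_one_sided (l : R) :
  P (X 0 @^-1` [set x | (x <= 0)%R]) = 0%E \/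
  P (X 0 @^-1` [set x | (0 <= x)%R]) = 0%E ->
  exists C : R, forall n : nat,
    (P (crosses_level X l n.+1) <= (C / Num.sqrt n.+1%:R)%:E)%E.
Proof.
move=> one_sided.
(* W is the null set of values of a step that break strict monotonicity. *)
have [W [mW W0 PW NW]] : exists W : set R, [/\ measurable W, W 0,
    P (X 0%N @^-1` W) = 0%E &
    forall w, (forall i, ~ W (X i w)) ->
      (forall i, 0 < X i w) \/ (forall i, X i w < 0)].
  case: one_sided => P0; [exists [set x | x <= 0]|exists [set x | 0 <= x]];
    split => //=; rewrite -?set_itvNyc -?set_itvcy//.
    by move=> w Xw; left => i; rewrite ltNge; apply/negP; exact: Xw.
  by move=> w Xw; right => i; rewrite ltNge; apply/negP; exact: Xw.
have mXW i : measurable (X i @^-1` W) by exact: measurable_funPTI.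
have X00 : P (X 0%N @^-1` [set 0]) = 0%E.
  apply/eqP; rewrite eq_le measure_ge0 andbT -PW.
  apply: le_measure; rewrite ?inE; [exact: measurable_funPTI|exact: mXW|].
  by move=> w /= ->.
have [delta d0 q0] := nonzero_step_quantile X00.
set Q := [set w | _] in q0.
have mQ : measurable Q.
  rewrite -[Q]setTI; apply: (measurable_fun_le measurableT) => //.
  exact: measurableT_comp.
pose N := \bigcup_i (X i @^-1` W).
have PN : P N = 0%E.
  apply/negligibleP; first exact: bigcup_measurable.
  apply: negligible_bigcup => i; apply/negligibleP => //.
  by rewrite -PW; exact: iidX.2.
pose q := fine (P Q).
have qE : P Q = q%:E by rewrite fineK ?fin_num_measure.
have q_gt0 : 0 < q by rewrite -lte_fin -qE.
have q_le1 : q <= 1 by rewrite -lee_fin -qE probability_le1.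
exists ((`|l| / delta + 2) / q) => n.
pose B := [set w | \sum_(i < n) `|X i w| <= `|l|].
have mB : measurable B.
  rewrite -[B]setTI; apply: (measurable_fun_le measurableT) => //.
  by apply: measurable_sum => i; exact: measurableT_comp.
apply: (@le_trans _ _ (P (N `|` B))).
  apply: le_measure; rewrite ?inE; [exact: measurable_crosses_levelS|..].
    by apply: measurableU => //; exact: bigcup_measurable.
  move=> w cw; have [Nw|Nw] := pselect (N w); [by left|right].
  by apply: crosses_monotone_abs cw; apply: NW => i Wi; apply: Nw; exists i.
apply: (@le_trans _ _ (P B)).
  apply: le_trans (measureU2 _ _ _) _ => //; first exact: bigcup_measurable.
  by rewrite -[leRHS]add0e; apply: leeD => //; rewrite -PN.
have := abs_walk_le n (normr_ge0 l) d0; rewrite -/B -/Q qE.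
have p_fin : P B \is a fin_num by exact: fin_num_measure.
have : (P B <= 1)%E by exact: probability_le1.
rewrite -(fineK p_fin) -!EFinM !lee_fin; set p := fine _ => p_le1 pnq.
have p_ge0 : 0 <= p by exact: fine_ge0.
have s1 : 1 <= Num.sqrt n.+1%:R :> R by rewrite -[leLHS]sqrtr1 ler_sqrt// ler1n.
have ss : Num.sqrt n.+1%:R * Num.sqrt n.+1%:R = n%:R + 1 :> R.
  by rewrite -expr2 sqr_sqrtr// -natr1.
have s0 := lt_le_trans ltr01 s1.
rewrite ler_pdivlMr// ler_pdivlMr//.
apply: (@le_trans _ _ (n%:R * (p * q) + p * q)).
  have -> : n%:R * (p * q) + p * q = (p * q) * (n%:R + 1) by ring.
  have pq0 : 0 <= p * q by rewrite mulr_ge0// ltW.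
  rewrite -ss; have := ler_wpM2l pq0 (ler_wpM2l (ltW s0) s1); lra.
have : p * q <= 1 by nra.
by lra.
Qed.

End LevelCrossing.

Theorem theorem2 (d : measure_display) (T : measurableType d) (R : realType)
    (P : probability T R) (X : nat -> {RV P >-> R}) (l : R) :
  iid X ->
  exists C : R, forall n : nat, (1 <= n)%N ->
    (P (crosses_level X l n) <= (C * n%:R `^ (- (1 / 2)))%:E)%E.
Proof.
move=> iidX.
suff [C HC] : exists C : R, forall n : nat,
    (P (crosses_level X l n.+1) <= (C / Num.sqrt n.+1%:R)%:E)%E.
  by exists C => -[//|n] _; rewrite powRN div1r powR12_sqrt.
have pos (A : set R) : measurable A ->
    P (X 0%N @^-1` A) = 0%E \/ (0 < P (X 0%N @^-1` A))%E.
  move=> mA; have := measure_ge0 P (X 0%N @^-1` A).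
  by rewrite le_eqVlt => /orP[/eqP<-|?]; [left|right].
have mm : measurable [set x : R | x <= 0] by rewrite -set_itvNyc.
have mp : measurable [set x : R | 0 <= x] by rewrite -set_itvcy.
have [pm|pm] := pos _ mm; first by apply: crosses_one_sided => //; left.
have [pp|pp] := pos _ mp; first by apply: crosses_one_sided => //; right.
exact: crosses_two_sided.
Qed.
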